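(* Let $\mathfrak g=(\mathfrak g_0\oplus\mathfrak g_{-1},d,[\cdot,\cdot],l_3)$ be a Lie $2$-algebra. For $(X,l_X)=(X_0,X_1,l_X)\in\mathrm{Der}^0(\mathfrak g)$ and $t\in\mathbb R$ put $\sigma_{(X,l_X)}(t)=(e^{tX_0},e^{tX_1},e^{tl_X})$, where $e^{tX_i}$ is the usual exponential and $$e^{tl_X}(x,y)=\sum_{n=1}^{\infty}\frac{t^n}{n!}\sum_{\substack{i+j+k=n-1\\ i,j,k\ge0}}\binom{i+j}{i}X_1^k\,l_X(X_0^ix,X_0^jy),\qquad x,y\in\mathfrak g_0 .$$ Then for all $(X,l_X)\in\mathrm{Der}^0(\mathfrak g)$ the map $t\mapsto\sigma_{(X,l_X)}(t)$ is a one-parameter subgroup of the Lie group $\mathrm{Aut}^0(\mathfrak g)$ determined by $(X,l_X)$ (i.e. with derivative $(X,l_X)$ at $t=0$). Consequently, the map $e:\mathrm{Der}^0(\mathfrak g)\to\mathrm{Aut}^0(\mathfrak g)$, $e^{(X,l_X)}=\sigma_{(X,l_X)}(1)$, is the exponential map of $\mathrm{Aut}^0(\mathfrak g)$.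
   Context: All vector spaces are real and finite-dimensional. A Lie $2$-algebra $\mathfrak g=(\mathfrak g_0\oplus\mathfrak g_{-1},d,[\cdot,\cdot],l_3)$ consists of vector spaces $\mathfrak g_0,\mathfrak g_{-1}$, a linear map $d:\mathfrak g_{-1}\to\mathfrak g_0$, a skew-symmetric bilinear bracket with $[x,y]\in\mathfrak g_0$, $[x,a]=-[a,x]\in\mathfrak g_{-1}$, $[a,b]=0$ for $x,y\in\mathfrak g_0$, $a,b\in\mathfrak g_{-1}$, and a skew-symmetric trilinear map $l_3:\wedge^3\mathfrak g_0\to\mathfrak g_{-1}$ such that for all $x,y,z,x_i\in\mathfrak g_0$, $a,b\in\mathfrak g_{-1}$: (a) $d[x,a]=[x,da]$, $[da,b]=[a,db]$; (b) $[[x,y],z]+[[y,z],x]+[[z,x],y]=-dl_3(x,y,z)$, $[[x,y],a]+[[y,a],x]+[[a,x],y]=-l_3(x,y,da)$; (c) $\sum_{i=1}^4(-1)^{i+1}[x_i,l_3(x_1,\dots,\hat x_i,\dots,x_4)]+\sum_{i<j}(-1)^{i+j}l_3([x_i,x_j],x_1,\dots,\hat x_i,\dots,\hat x_j,\dots,x_4)=0$. A Lie $2$-algebra homomorphism $A=(A_0,A_1,A_2):\mathfrak g\to\mathfrak g$ consists of linear maps $A_0\in\mathrm{End}(\mathfrak g_0)$, $A_1\in\mathrm{End}(\mathfrak g_{-1})$ with $d\circ A_1=A_0\circ d$ and $A_2:\wedge^2\mathfrak g_0\to\mathfrak g_{-1}$ such that $A_0[x,y]-[A_0x,A_0y]=dA_2(x,y)$,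 $A_1[x,a]-[A_0x,A_1a]=A_2(x,da)$, and $[A_0x,A_2(y,z)]+c.p.+l_3(A_0x,A_0y,A_0z)=A_2([x,y],z)+c.p.+A_1l_3(x,y,z)$ ($c.p.$: remaining cyclic permutations of $x,y,z$). $\mathrm{Aut}^0(\mathfrak g)$ is the Lie group of those with $A_0,A_1$ invertible, under $(B\diamond A)_0=B_0A_0$, $(B\diamond A)_1=B_1A_1$, $(B\diamond A)_2=B_2\circ(A_0\times A_0)+B_1\circ A_2$, with identity $(I,I,0)$. $\mathrm{Der}^0(\mathfrak g)$ is the set of triples $(X_0,X_1,l_X)$ with $X_0\in\mathrm{End}(\mathfrak g_0)$, $X_1\in\mathrm{End}(\mathfrak g_{-1})$, $X_0\circ d=d\circ X_1$, and $l_X:\wedge^2\mathfrak g_0\to\mathfrak g_{-1}$ linear such that $dl_X(x,y)=X_0[x,y]-[X_0x,y]-[x,X_0y]$, $l_X(x,da)=X_1[x,a]-[X_0x,a]-[x,X_1a]$, and $X_1l_3(x,y,z)=\big(l_X(x,[y,z])+[x,l_X(y,z)]+l_3(X_0x,y,z)\big)+c.p.(x,y,z)$. It is identified with the tangent space of $\mathrm{Aut}^0(\mathfrak g)$ at the identity, inside $\mathrm{End}(\mathfrak g_0)\oplus\mathrm{End}(\mathfrak g_{-1})\oplus\mathrm{Hom}(\wedge^2\mathfrak g_0,\mathfrak g_{-1})$. *)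

(* Defs.v *)
From HB Require Import structures.
From mathcomp Require Import all_boot all_order all_algebra.
From mathcomp Require Import all_classical all_reals all_analysis.

Set Implicit Arguments.
Unset Strict Implicit.
Unset Printing Implicit Defensive.

Import Order.TTheory GRing.Theory Num.Theory numFieldNormedType.Exports.

Local Open Scope classical_set_scope.
Local Open Scope ring_scope.

(* A vectType carries no topology in the library.  Limits and derivatives in
   V are those of the coordinates in a fixed basis; since linear isomorphisms
   of finite-dimensional real vector spaces are homeomorphisms, the choice of
   the basis is irrelevant. *)
Section FiniteDimensionalCalculus.
Context {R : realType} {V : vectType R}.

Definition coords (v : V) : 'rV[R]_(\dim {:V}) := passmx.rVof (vbasis {:V}) v.

Definition of_coords (r : 'rV[R]_(\dim {:V})) : V := passmx.vecof (vbasis {:V}) r.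

Definition vconverges (u : nat -> V) (l : V) : Prop :=
  coords (u n) @[n --> \oo] --> coords l.

Definition vlim (u : nat -> V) : V :=
  of_coords (lim (coords (u n) @[n --> \oo])).

Definition smooth_curve (c : R -> V) : Prop :=
  forall (n : nat) (t : R), derivable (derive1n n (coords \o c)) t 1.

Definition has_velocity (c : R -> V) (t : R) (v : V) : Prop :=
  is_derive t (1 : R) (coords \o c) (coords v).

End FiniteDimensionalCalculus.

Definition lfun_exp {R : realType} {V : vectType R} (f : 'End(V)) :
    'End(V) :=
  vlim (fun N => \sum_(0 <= n < N) (n`!%:R)^-1 *: iter n (comp_lfun f) \1%VF).

(* The bilinear map (x, y) |-> f x y; meaningful only when f is bilinear. *)
Definition bilinfun {R : realType} {U V W : vectType R} (f : U -> V -> W) :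
    'Hom(U, 'Hom(V, W)) :=
  linfun (fun x : U => linfun (f x)).

(* br00 x y = [x, y], br01 x a = [x, a] and br10 a x = [a, x], for x, y in
   g_0 = V0 and a in g_{-1} = V1; the bracket of two elements of g_{-1} is
   zero. *)
Record lie2_algebra (R : realType) (V0 V1 : vectType R) := Lie2Algebra {
  l2d : 'Hom(V1, V0);
  br00 : 'Hom(V0, 'Hom(V0, V0));
  br01 : 'Hom(V0, 'Hom(V1, V1));
  br10 : V1 -> V0 -> V1 := fun a x => - br01 x a;
  l3 : 'Hom(V0, 'Hom(V0, 'Hom(V0, V1)));
  br00_skew : forall x y, br00 x y = - br00 y x;
  l3_skew12 : forall x y z, l3 x y z = - l3 y x z;
  l3_skew23 : forall x y z, l3 x y z = - l3 x z y;
  l2d_br01 : forall x a, l2d (br01 x a) = br00 x (l2d a);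
  br01_l2d : forall a b, br01 (l2d a) b = br10 a (l2d b);
  jacobi00 : forall x y z,
    br00 (br00 x y) z + br00 (br00 y z) x + br00 (br00 z x) y
      = - l2d (l3 x y z);
  jacobi01 : forall x y a,
    br01 (br00 x y) a + br10 (br01 y a) x + br10 (br10 a x) y
      = - l3 x y (l2d a);
  l3_coherence : forall x1 x2 x3 x4,
    br01 x1 (l3 x2 x3 x4) - br01 x2 (l3 x1 x3 x4)
    + br01 x3 (l3 x1 x2 x4) - br01 x4 (l3 x1 x2 x3)
    + (- l3 (br00 x1 x2) x3 x4 + l3 (br00 x1 x3) x2 x4
       - l3 (br00 x1 x4) x2 x3 - l3 (br00 x2 x3) x1 x4
       + l3 (br00 x2 x4) x1 x3 - l3 (br00 x3 x4) x1 x2) = 0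
}.

(* The ambient space End(g_0) (+) End(g_{-1}) (+) Hom(g_0 (x) g_0, g_{-1});
   skew-symmetry of the third component is imposed in Aut0 and Der0, so that
   it lies in Hom(/\^2 g_0, g_{-1}). *)
Definition triple {R : realType} (V0 V1 : vectType R) : vectType R :=
  ('End(V0) * 'End(V1) * 'Hom(V0, 'Hom(V0, V1)))%type.

Section Lie2Groups.
Context {R : realType} {V0 V1 : vectType R}.
Implicit Types (g : lie2_algebra V0 V1) (A B X : triple V0 V1).

Definition mk_triple (A0 : 'End(V0)) (A1 : 'End(V1))
    (A2 : 'Hom(V0, 'Hom(V0, V1))) : triple V0 V1 := (A0, A1, A2).
Definition part0 A : 'End(V0) := A.1.1.
Definition part1 A : 'End(V1) := A.1.2.
Definition part2 A : 'Hom(V0, 'Hom(V0, V1)) := A.2.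

Record lie2_hom g A : Prop := Lie2Hom {
  hom_skew : forall x y, part2 A x y = - part2 A y x;
  hom_l2d : forall a, l2d g (part1 A a) = part0 A (l2d g a);
  hom_br00 : forall x y,
    part0 A (br00 g x y) - br00 g (part0 A x) (part0 A y)
      = l2d g (part2 A x y);
  hom_br01 : forall x a,
    part1 A (br01 g x a) - br01 g (part0 A x) (part1 A a)
      = part2 A x (l2d g a);
  hom_l3 : forall x y z,
    br01 g (part0 A x) (part2 A y z) + br01 g (part0 A y) (part2 A z x)
    + br01 g (part0 A z) (part2 A x y)
    + l3 g (part0 A x) (part0 A y) (part0 A z)
      = part2 A (br00 g x y) z + part2 A (br00 g y z) x
        + part2 A (br00 g z x) y + part1 A (l3 g x y z)
}.

Definition Aut0 g : set (triple V0 V1) :=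
  [set A | [/\ lie2_hom g A, bijective (part0 A) & bijective (part1 A)]].

Definition aut_comp B A : triple V0 V1 :=
  mk_triple (part0 B \o part0 A)%VF (part1 B \o part1 A)%VF
    (bilinfun (fun x y =>
       part2 B (part0 A x) (part0 A y) + part1 B (part2 A x y))).

Definition aut_id : triple V0 V1 := mk_triple \1%VF \1%VF 0.

Record derivation0 g X : Prop := Derivation0 {
  der_skew : forall x y, part2 X x y = - part2 X y x;
  der_l2d : forall a, part0 X (l2d g a) = l2d g (part1 X a);
  der_br00 : forall x y,
    l2d g (part2 X x y)
      = part0 X (br00 g x y) - br00 g (part0 X x) y - br00 g x (part0 X y);
  der_br01 : forall x a,
    part2 X x (l2d g a)
      = part1 X (br01 g x a) - br01 g (part0 X x) a - br01 g x (part1 X a);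
  der_l3 : forall x y z,
    let S x y z := part2 X x (br00 g y z) + br01 g x (part2 X y z)
                   + l3 g (part0 X x) y z in
    part1 X (l3 g x y z) = S x y z + S y z x + S z x y
}.

Definition Der0 g : set (triple V0 V1) := [set X | derivation0 g X].

(* Aut0 g is an embedded submanifold of the ambient space, so a curve in it is
   smooth, with a given velocity, iff it is so as a curve in [triple V0 V1]. *)
Definition one_parameter_subgroup g (c : R -> triple V0 V1) : Prop :=
  [/\ forall t, Aut0 g (c t), smooth_curve c, c 0 = aut_id
    & forall s t, c (s + t) = aut_comp (c s) (c t)].

Definition one_parameter_subgroup_of g X (c : R -> triple V0 V1) : Prop :=
  one_parameter_subgroup g c /\ has_velocity c 0 X.

(* The Lie algebra of Aut0 g, i.e. its tangent space at aut_id, is Der0 g. *)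
Definition is_exponential_map g (e : triple V0 V1 -> triple V0 V1) : Prop :=
  forall X, Der0 g X ->
    [/\ Aut0 g (e X), exists! c, one_parameter_subgroup_of g X c
      & forall c, one_parameter_subgroup_of g X c -> e X = c 1].

Definition exp2_partial_sum X (t : R) (x y : V0) (N : nat) : V1 :=
  \sum_(1 <= n < N.+1) (t ^+ n / n`!%:R) *:
    \sum_(i < n) \sum_(j < n) \sum_(k < n | (i + j + k == n.-1)%N)
      'C(i + j, i)%:R *:
        iter k (part1 X) (part2 X (iter i (part0 X) x) (iter j (part0 X) y)).

Definition exp2 X (t : R) : 'Hom(V0, 'Hom(V0, V1)) :=
  bilinfun (fun x y => vlim (exp2_partial_sum X t x y)).

Definition sigma X (t : R) : triple V0 V1 :=
  mk_triple (lfun_exp (t *: part0 X)) (lfun_exp (t *: part1 X)) (exp2 X t).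

End Lie2Groups.

(* Main.v *)
Require Import Defs.
From HB Require Import structures.
From mathcomp Require Import all_boot all_order all_algebra.
From mathcomp Require Import zify ring.
From mathcomp Require Import all_classical all_reals all_analysis.

(* Right multiplication makes Aut^0 act linearly on the ambient space: the
   velocity at s = 0 of A \diamond c(s), where c(0) = 1 and c has velocity X
   at 0, is rho_X(A) = (A_0 X_0, A_1 X_1,
   A_2(X_0 _, _) + A_2(_, X_0 _) + A_1 l_X(_, _)), which is linear in A.
   Hence a one-parameter subgroup with velocity X solves the linear equation
   c' = rho_X(c), c(0) = 1, and is unique.  Pascal's rule identifies the
   components of rho_X^n(1) with the coefficients of the series defining
   sigma_X, so sigma_X is this solution, and the group law follows from
   uniqueness again.  Each homomorphism identity for A = sigma_X(s), evaluated
   at the moving arguments e^((t-s)X) x, has derivative zero in s by the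
   derivation identities for X, and holds at s = 0; at s = t it is the
   identity for sigma_X(t). *)

Set Implicit Arguments.
Unset Strict Implicit.
Unset Printing Implicit Defensive.

Import Order.TTheory GRing.Theory Num.Theory numFieldNormedType.Exports.

Local Open Scope classical_set_scope.
Local Open Scope ring_scope.

(** * Limits and velocities in coordinates *)

Section Coordinates.
Context {R : realType}.
Implicit Types V W : vectType R.

Lemma coordsK V : cancel (@coords R V) of_coords.
Proof. exact: passmx.rVofK (vbasisP _). Qed.

Lemma of_coordsK V : cancel of_coords (@coords R V).
Proof. exact: passmx.vecofK (vbasisP _). Qed.

Lemma coordsP V (u v : V) :
  (forall i, coords u 0 i = coords v 0 i) -> u = v.
Proof. by move=> uv; apply: (can_inj (@coordsK V)); apply/rowP. Qed.

HB.instance Definition _ V :=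
  GRing.isSemilinear.Build R V 'rV_(\dim {:V}) _ (@coords R V)
    (GRing.semilinear_linear (passmx.rVof_linear (vbasis {:V}))).

Lemma coords_sum_basis V (v : V) : v = \sum_i coords v 0 i *: (vbasis {:V})`_i.
Proof. by rewrite -[LHS]coordsK. Qed.

Lemma coord_linear V W (L : {linear V -> W}) (v : V) j :
  coords (L v) 0 j = \sum_i coords v 0 i * coords (L (vbasis {:V})`_i) 0 j.
Proof.
rewrite {1}(coords_sum_basis v) !linear_sum summxE.
by apply: eq_bigr => i _; rewrite !linearZ mxE.
Qed.

Lemma coord_le_norm V (v : V) i : `|coords v 0 i| <= `|coords v|.
Proof.
rewrite [leRHS]/Num.Def.normr/= mx_normrE.
exact: (le_bigmax _ (fun ij => `|coords v ij.1 ij.2|) (0, i)).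
Qed.

(** The constant is the sum of the absolute values of all matrix entries of L. This crude bound is
    what makes the iterates of L grow at most geometrically. *)
Lemma linear_coords_bounded V W (L : {linear V -> W}) :
  exists2 K, 0 <= K & forall v : V, `|coords (L v)| <= K * `|coords v|.
Proof.
pose a (i : 'I_(\dim {:V})) j := `|coords (L (vbasis {:V})`_i) 0 j|.
have a_ge0 i : 0 <= \sum_j a i j by apply: sumr_ge0 => j _; exact: normr_ge0.
have K_ge0 : 0 <= \sum_i \sum_j a i j by apply: sumr_ge0.
exists (\sum_i \sum_j a i j) => //.
move=> v; rewrite [leLHS]/Num.Def.normr/= mx_normrE.
apply: bigmax_le => [|[k j] _ /=]; first exact: mulr_ge0.
rewrite (ord1 k) coord_linear (le_trans (ler_norm_sum _ _ _))// mulr_suml.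
apply: ler_sum => i _; rewrite normrM mulrC ler_pM// ?coord_le_norm//.
by rewrite (bigD1 j)//= lerDl; apply: sumr_ge0 => k' _; exact: normr_ge0.
Qed.

End Coordinates.

Section Convergence.
Context {R : realType}.
Implicit Types V W : vectType R.

Lemma vconvergesP V (u : nat -> V) (l : V) :
  vconverges u l <->
  forall i, (coords (u n) 0 i @[n --> \oo] --> coords l 0 i)%classic.
Proof.
split=> [ul i|ul].
  apply/cvgrPdist_le => e e0; move/cvgrPdist_le : ul => /(_ _ e0).
  apply: filterS => n; apply: le_trans.
  by have := coord_le_norm (l - u n) i; rewrite linearB !mxE.
apply/cvgrPdist_le => e e0.
near=> n.
rewrite [leLHS]/Num.Def.normr/= mx_normrE (bigmax_le _ (ltW e0))//= => -[k i] _.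
rewrite (ord1 k) mxE [X in _ + X]mxE/=; move: i {k}; near: n.
apply: filter_forall => /= i.
by have /cvgrPdist_le/(_ _ e0) := ul i.
Unshelve. all: by end_near. Qed.

Lemma vlimE V (u : nat -> V) (l : V) : vconverges u l -> vlim u = l.
Proof. by move=> ul; rewrite /vlim (cvg_lim _ ul)// coordsK. Qed.

Lemma vconverges_linear V W (L : {linear V -> W}) (u : nat -> V) (l : V) :
  vconverges u l -> vconverges (L \o u) (L l).
Proof.
move=> /vconvergesP ul; apply/vconvergesP => j /=.
rewrite coord_linear; under eq_fun do rewrite coord_linear.
apply: cvg_big => [|i _]; first exact: add_continuous.
by apply: cvgMl; exact: ul.
Qed.

End Convergence.

Section Evaluation.
Context {R : realType} {V W : vectType R}.

(** Named so that F |-> F x carries a linear structure and the results on limits and velocities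
    under linear maps apply to it. *)
Definition eval_lfun (x : V) (F : 'Hom(V, W)) : W := F x.

Lemma eval_lfun_linear x : linear (eval_lfun x).
Proof. by move=> a F G; rewrite /eval_lfun add_lfunE scale_lfunE. Qed.

HB.instance Definition _ x :=
  GRing.isSemilinear.Build R 'Hom(V, W) W _ (eval_lfun x)
    (GRing.semilinear_linear (eval_lfun_linear x)).

End Evaluation.

(* [linearD] and its variants leave the canonical linear structure of a
   ['Hom(V, W)] in the goal, where it blocks further rewriting. *)
Section ApplicationIsAdditive.
Context {R : realType} {V W : vectType R} (F : 'Hom(V, W)).

Lemma lfun0 : F 0 = 0. Proof. exact: linear0. Qed.
Lemma lfunD u v : F (u + v) = F u + F v. Proof. exact: linearD. Qed.
Lemma lfunN u : F (- u) = - F u. Proof. exact: linearN. Qed.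
Lemma lfunB u v : F (u - v) = F u - F v. Proof. exact: linearB. Qed.

End ApplicationIsAdditive.

(** * Differentiation rules for curves in a vector space *)

Section Velocity.
Context {R : realType}.
Implicit Types (U V W : vectType R) (s t : R).

Lemma has_velocityP V (c : R -> V) t (v : V) :
  has_velocity c t v <->
  forall i, is_derive t (1 : R) (fun s => coords (c s) 0 i) (coords v 0 i).
Proof.
split=> [[dc dcE] i|dc].
  have dci := (derivable_mxP _ _ _).1 dc.
  by apply: DeriveDef; [exact: dci|rewrite -dcE derive_mx// mxE].
have dcoords : derivable (coords \o c) t 1.
  by apply/derivable_mxP => i j; rewrite (ord1 i); apply: ex_derive.
by apply: DeriveDef => //; rewrite derive_mx//; apply/rowP => i;
  rewrite mxE; apply: derive_val.
Qed.

Lemma has_velocity_cst V (v : V) t : has_velocity (fun=> v) t 0.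
Proof. by rewrite /has_velocity linear0; exact: is_derive_cst. Qed.

Lemma has_velocityD V (c d : R -> V) t (v w : V) :
  has_velocity c t v -> has_velocity d t w ->
  has_velocity (fun s => c s + d s) t (v + w).
Proof.
rewrite /has_velocity => cv dw; rewrite linearD.
rewrite (_ : _ \o _ = (coords \o c) \+ (coords \o d)).
  exact: (is_deriveD cv dw).
by apply/funext => s /=; rewrite linearD.
Qed.

Lemma has_velocityN V (c : R -> V) t (v : V) :
  has_velocity c t v -> has_velocity (fun s => - c s) t (- v).
Proof.
rewrite /has_velocity => cv; rewrite linearN.
rewrite (_ : _ \o _ = \- (coords \o c)); first exact: (is_deriveN cv).
by apply/funext => s /=; rewrite linearN.
Qed.

Lemma has_velocityB V (c d : R -> V) t (v w : V) :
  has_velocity c t v -> has_velocity d t w ->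
  has_velocity (fun s => c s - d s) t (v - w).
Proof. by move=> cv dw; apply: has_velocityD => //; exact: has_velocityN. Qed.

Lemma has_velocity_sum V n (c : 'I_n -> R -> V) t (v : 'I_n -> V) :
  (forall i, has_velocity (c i) t (v i)) ->
  has_velocity (fun s => \sum_i c i s) t (\sum_i v i).
Proof.
move=> cv; rewrite /has_velocity linear_sum.
rewrite [X in is_derive _ _ X](_ : _ = \sum_i (coords \o c i)).
  by apply: is_derive_sum => i; exact: cv.
by apply/funext => s /=; rewrite linear_sum fct_sumE.
Qed.

Lemma has_velocityZ V (f : R -> R) (c : R -> V) t (df : R) (v : V) :
  is_derive t 1 f df -> has_velocity c t v ->
  has_velocity (fun s => f s *: c s) t (df *: c t + f t *: v).
Proof.
move=> dfP /has_velocityP cv; apply/has_velocityP => i.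
rewrite [X in is_derive _ _ X](_ : _ = f * (fun s => coords (c s) 0 i)).
  rewrite (_ : coords _ 0 i = f t *: coords v 0 i + coords (c t) 0 i *: df).
    by apply: is_deriveM; exact: cv.
  by rewrite linearD !linearZ !mxE addrC [df * _]mulrC.
by apply/funext => s /=; rewrite linearZ mxE.
Qed.

(** Expanding c in the basis turns L \o c into a combination of fixed vectors with the coordinates
    of c as coefficients, so only the product rule with constant vectors is needed. *)
Lemma has_velocity_linear V W (L : {linear V -> W}) (c : R -> V) t (v : V) :
  has_velocity c t v -> has_velocity (L \o c) t (L v).
Proof.
move=> cv.
rewrite (_ : L \o c = fun s => \sum_i coords (c s) 0 i *: L (vbasis {:V})`_i).
  rewrite {1}(coords_sum_basis v) linear_sum; apply: has_velocity_sum => i.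
  have ci := (has_velocityP _ _ _).1 cv i.
  have := has_velocityZ ci (has_velocity_cst (L (vbasis {:V})`_i) t).
  by rewrite scaler0 addr0 linearZ.
apply/funext => s /=; rewrite {1}(coords_sum_basis (c s)) linear_sum.
by apply: eq_bigr => i _; rewrite linearZ.
Qed.

Lemma has_velocity_lfun V W (L : 'Hom(V, W)) (c : R -> V) t (v : V) :
  has_velocity c t v -> has_velocity (fun s => L (c s)) t (L v).
Proof. exact: has_velocity_linear. Qed.

Lemma has_velocity_eval V W (F : R -> 'Hom(V, W)) t (F' : 'Hom(V, W)) x :
  has_velocity F t F' -> has_velocity (fun s => F s x) t (F' x).
Proof. exact: (has_velocity_linear (eval_lfun x)). Qed.

(** Leibniz rule for the bilinear evaluation map. Expanding c(s) in the basis reduces it to products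
    of a scalar curve and a vector curve. *)
Lemma has_velocity_app V W (F : R -> 'Hom(V, W)) (c : R -> V) t
    (F' : 'Hom(V, W)) (c' : V) :
  has_velocity F t F' -> has_velocity c t c' ->
  has_velocity (fun s => F s (c s)) t (F' (c t) + F t c').
Proof.
move=> FF' cc'.
have appE (G : 'Hom(V, W)) v :
    G v = \sum_i coords v 0 i *: G (vbasis {:V})`_i.
  rewrite {1}(coords_sum_basis v) linear_sum.
  by apply: eq_bigr => i _; rewrite linearZ.
rewrite (_ : (fun s => F s (c s)) =
    fun s => \sum_i coords (c s) 0 i *: F s (vbasis {:V})`_i); last first.
  by apply/funext => s; rewrite appE.
rewrite (appE F') (appE (F t) c') addrC -big_split.
apply: has_velocity_sum => i; apply: has_velocityZ.
  exact: (has_velocityP _ _ _).1 cc' i.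
exact: has_velocity_eval.
Qed.

End Velocity.

Section ConstantAndReparametrisedCurves.
Context {R : realType} {V : vectType R}.
Implicit Types (c : R -> V) (f : R -> R).

Lemma velocity0_cst c : (forall s, has_velocity c s 0) -> forall s t, c s = c t.
Proof.
move=> c0 s t; apply: coordsP => i.
apply: (@is_derive_0_is_cst _ (fun s => coords (c s) 0 i)) => r.
by have := (has_velocityP _ _ _).1 (c0 r) i; rewrite linear0 mxE.
Qed.

Lemma has_velocity_comp c f t (v : V) (df : R) :
  has_velocity c (f t) v -> is_derive t 1 f df ->
  has_velocity (c \o f) t (df *: v).
Proof.
move=> /has_velocityP cv fP; apply/has_velocityP => i.
rewrite linearZ mxE mulrC.
exact: (@is_derive1_comp _ (fun s => coords (c s) 0 i) _ _ _ _ (cv i) fP).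
Qed.

Lemma has_velocity_shift c r t (v : V) :
  has_velocity c (r + t) v -> has_velocity (fun s => c (r + s)) t v.
Proof.
move=> cv; rewrite -[v]scale1r.
apply: (has_velocity_comp (f := fun s => r + s)) => //.
by have := is_deriveD (is_derive_cst r t 1) (is_derive_id t 1); rewrite add0r.
Qed.

Lemma has_velocity_rev c r t (v : V) :
  has_velocity c (r - t) v -> has_velocity (fun s => c (r - s)) t (- v).
Proof.
move=> cv; rewrite -scaleN1r.
apply: (has_velocity_comp (f := fun s => r - s)) => //.
have := is_deriveD (is_derive_cst r t 1) (is_deriveNid t 1).
by rewrite add0r.
Qed.

End ConstantAndReparametrisedCurves.

(** * Exponential series and linear differential equations *)

Section PowerCurves.
Context {R : realType}.
Implicit Types V W : vectType R.

(** Growth condition under which the series of terms t^n / n! w_n converges for every t; it is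
    stable under shifts and linear maps. *)
Definition geometrically_bounded V (w : nat -> V) : Prop :=
  exists C K : R, forall n, `|coords (w n)| <= C * K ^+ n.

Definition power_sum V (w : nat -> V) (t : R) (N : nat) : V :=
  \sum_(0 <= n < N) (t ^+ n / n`!%:R) *: w n.

(** The exponential generating function of w: because of the factorials, differentiating it shifts
    w. *)
Definition power_curve V (w : nat -> V) (t : R) : V := vlim (power_sum w t).

Lemma geometrically_bounded_shift V (w : nat -> V) :
  geometrically_bounded w -> geometrically_bounded (fun n => w n.+1).
Proof.
by move=> [C [K wCK]]; exists (C * K), K => n; rewrite -mulrA -exprS.
Qed.

Lemma geometrically_bounded_linear V W (L : {linear V -> W}) (w : nat -> V) :
  geometrically_bounded w -> geometrically_bounded (L \o w).
Proof.
move=> [C [K wCK]]; have [M M_ge0 LM] := linear_coords_bounded L.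
exists (M * C), K => n; rewrite (le_trans (LM _))// -mulrA.
by rewrite ler_wpM2l.
Qed.

Lemma geometrically_bounded_iter V (f : {linear V -> V}) (v : V) :
  geometrically_bounded (fun n => iter n f v).
Proof.
have [K K_ge0 fK] := linear_coords_bounded f.
exists `|coords v|, K; elim=> [|n IHn]; first by rewrite expr0 mulr1.
by rewrite iterS (le_trans (fK _))// exprS mulrCA ler_wpM2l.
Qed.

(** Absolute convergence by comparison with C times the series of e^(K|t|). *)
Lemma cvg_pseries_fact (a : nat -> R) (C K t : R) :
  (forall n, `|a n| <= C * K ^+ n) ->
  cvgn (pseries (fun n => a n / n`!%:R) t).
Proof.
move=> aCK; apply: normed_cvg.
have le n : `|a n / n`!%:R * t ^+ n| <= C * exp_coeff (K * `|t|) n.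
  rewrite /exp_coeff/= exprMn normrM normrX normf_div [`|n`!%:R|]ger0_norm//.
  by rewrite mulrAC !mulrA ler_wpM2r// ler_wpM2r// exprn_ge0.
apply: (@series_le_cvg _ _ (fun n => C * exp_coeff (K * `|t|) n)) => //.
- by move=> n /=.
- by move=> n; exact: le_trans (normr_ge0 _) (le n).
rewrite [X in cvgn X](_ : _ = C *: series (exp_coeff (K * `|t|))).
  by apply: is_cvgZr; exact: is_cvg_series_exp_coeff.
by apply/funext => n /=; rewrite /series/= -mulr_sumr.
Qed.

Lemma coords_power_sum V (w : nat -> V) t i :
  (fun N => coords (power_sum w t N) 0 i) =
  pseries (fun n => coords (w n) 0 i / n`!%:R) t.
Proof.
apply/funext => N; rewrite /power_sum linear_sum summxE /pseries/series/=.
by apply: eq_bigr => n _; rewrite linearZ [LHS]mxE -mulrA mulrC [_^-1 * _]mulrC.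
Qed.

Lemma cvg_coords_power_sum V (w : nat -> V) t i :
  geometrically_bounded w ->
  cvgn (pseries (fun n => coords (w n) 0 i / n`!%:R) t).
Proof.
move=> [C [K wCK]]; apply: (@cvg_pseries_fact _ C K) => n.
exact: le_trans (coord_le_norm _ _) (wCK n).
Qed.

Lemma power_sum_cvg V (w : nat -> V) t :
  geometrically_bounded w -> vconverges (power_sum w t) (power_curve w t).
Proof.
move=> wb.
suff cl : vconverges (power_sum w t) (of_coords (\row_i
    limn (pseries (fun n => coords (w n) 0 i / n`!%:R) t))).
  by rewrite /power_curve (vlimE cl).
apply/vconvergesP => i; rewrite coords_power_sum of_coordsK mxE.
exact: cvg_coords_power_sum.
Qed.

Lemma coords_power_curve V (w : nat -> V) i :
  geometrically_bounded w ->
  (fun t => coords (power_curve w t) 0 i) =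
  (fun t => limn (pseries (fun n => coords (w n) 0 i / n`!%:R) t)).
Proof.
move=> wb; apply/funext => t; apply/esym/cvg_lim => //.
by rewrite -coords_power_sum; move: i; apply/vconvergesP/power_sum_cvg.
Qed.

Lemma power_curve_velocity V (w : nat -> V) t :
  geometrically_bounded w ->
  has_velocity (power_curve w) t (power_curve (fun n => w n.+1) t).
Proof.
move=> wb; have wb1 := geometrically_bounded_shift wb.
have wb2 := geometrically_bounded_shift wb1.
(* The formal derivative multiplies the coefficient of index n+1 by n+1, and (n+1) / (n+1)! = 1 /
   n!. *)
have diffsE (u : nat -> V) i :
    pseries_diffs (fun n => coords (u n) 0 i / n`!%:R) =
    (fun n => coords (u n.+1) 0 i / n`!%:R).
  apply/funext => n; rewrite /pseries_diffs mulrCA factS natrM invfM.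
  by rewrite mulVKf.
apply/has_velocityP => i; rewrite coords_power_curve//.
have /= := congr1 (fun f => f t) (coords_power_curve i wb1) => ->.
rewrite -(diffsE w i).
(* Termwise differentiation at t asks that the series and its first two formal derivatives converge
   at some point of modulus larger than |t|; any such point works, as all three converge
   everywhere. *)
apply: (@pseries_snd_diffs _ _ (`|t| + 1)); rewrite ?diffsE.
- exact: cvg_coords_power_sum.
- exact: cvg_coords_power_sum.
- exact: cvg_coords_power_sum.
- by rewrite [ltRHS]ger0_norm// ltrDl.
Qed.

Lemma power_curve_linear V W (L : {linear V -> W}) (w : nat -> V) t :
  geometrically_bounded w -> L (power_curve w t) = power_curve (L \o w) t.
Proof.
move=> wb; apply/esym/vlimE.
rewrite (_ : power_sum _ _ = L \o power_sum w t).
  exact/vconverges_linear/power_sum_cvg.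
apply/funext => N /=; rewrite /power_sum linear_sum.
by apply: eq_bigr => n _; rewrite linearZ.
Qed.

Lemma power_curve0 V (w : nat -> V) : power_curve w 0 = w 0%N.
Proof.
(* At t = 0 every partial sum but the empty one equals w 0, since 0^0 = 1 and the other powers of 0
   vanish. *)
apply: vlimE; apply: cvg_near_cst; exists 1%N => // -[//|N] _ /=.
rewrite /power_sum big_nat_recl// expr0 fact0 divr1 scale1r.
rewrite big1 ?addr0// => n _.
by rewrite expr0n mul0r scale0r.
Qed.

Lemma geometrically_bounded_addn V (w : nat -> V) k :
  geometrically_bounded w -> geometrically_bounded (fun n => w (n + k)%N).
Proof.
move=> wb; elim: k => [|k IHk]; first by under eq_fun do rewrite addn0.
by have := geometrically_bounded_shift IHk; under eq_fun do rewrite addSnnS.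
Qed.

Lemma power_curve_derive1n V (w : nat -> V) k :
  geometrically_bounded w ->
  derive1n k (coords \o power_curve w) =
  coords \o power_curve (fun n => w (n + k)%N).
Proof.
move=> wb; elim: k => [|k IHk]; first by under [in RHS]eq_fun do rewrite addn0.
rewrite derive1nS IHk; apply/funext => t; rewrite derive1E.
have [_ ->] := power_curve_velocity t (geometrically_bounded_addn k wb).
by under eq_fun do rewrite addSnnS.
Qed.

Lemma power_curve_smooth V (w : nat -> V) :
  geometrically_bounded w -> smooth_curve (power_curve w).
Proof.
move=> wb n t; rewrite power_curve_derive1n//.
by have [] := power_curve_velocity t (geometrically_bounded_addn n wb).
Qed.

End PowerCurves.

Section LinearMaps.
Context {R : realType}.
Implicit Types U V W : vectType R.

Lemma linfunE V W (f : V -> W) : linear f -> linfun f =1 f.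
Proof.
move=> f_lin v.
pose f' : {linear V -> W} := HB.pack f
  (GRing.isSemilinear.Build R V W _ f (GRing.semilinear_linear f_lin)).
exact: (lfunE f' v).
Qed.

Lemma bilinfunE U V W (f : U -> V -> W) :
  (forall y, linear (f^~ y)) -> (forall x, linear (f x)) ->
  forall x y, bilinfun f x y = f x y.
Proof.
move=> linl linr x y; rewrite /bilinfun linfunE ?linfunE// => a u v.
by apply/lfunP => z; rewrite add_lfunE scale_lfunE !linfunE// linl.
Qed.

Lemma bilinfun_lfun U V W (F : 'Hom(U, 'Hom(V, W))) :
  bilinfun (fun x y => F x y) = F.
Proof.
apply/lfunP => x; apply/lfunP => y.
by rewrite bilinfunE// => [z a u v|z a u v];
  rewrite linearP ?add_lfunE ?scale_lfunE.
Qed.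

End LinearMaps.

(** * Linear autonomous differential equations *)

Section Flow.
Context {R : realType}.
Implicit Types V W : vectType R.

Definition flow V (f : 'End(V)) (v : V) : R -> V :=
  power_curve (fun n => iter n f v).

Lemma flow0 V (f : 'End(V)) v : flow f v 0 = v.
Proof. by rewrite /flow power_curve0. Qed.

Lemma flow_velocity V (f : 'End(V)) v t :
  has_velocity (flow f v) t (f (flow f v t)).
Proof.
have vb := geometrically_bounded_iter f v.
by rewrite /flow (power_curve_linear f t vb); exact: power_curve_velocity.
Qed.

Lemma flow_smooth V (f : 'End(V)) v : smooth_curve (flow f v).
Proof. exact/power_curve_smooth/geometrically_bounded_iter. Qed.

(** With E(t) = e^(tf), the curve s |-> E(t - s) d(s) is constant for every solution d, so its
    values at s = t and s = 0 give d(t) = E(t) d(0). Both c and the flow through c(0) are such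
    solutions. *)
Lemma linear_ode_unique V (f : 'End(V)) (c : R -> V) :
  (forall t, has_velocity c t (f (c t))) -> c = flow f (c 0).
Proof.
(* E is the flow of composition with f on the right: its velocity E \o f then cancels directly
   against E applied to f (d s). *)
pose rf : 'End('End(V)) := linfun (fun F : 'End(V) => (F \o f)%VF).
have rfE F : rf F = (F \o f)%VF.
  by rewrite linfunE// => a u v; apply/lfunP => x; rewrite !lfun_simp.
pose E := flow rf \1%VF.
have Eflow d : (forall t, has_velocity d t (f (d t))) -> forall t,
    d t = E t (d 0).
  move=> df t.
  have cst s : has_velocity (fun s => E (t - s) (d s)) s 0.
    have := has_velocity_app
      (has_velocity_rev (flow_velocity rf \1%VF (t - s))) (df s).
    by rewrite rfE opp_lfunE comp_lfunE addNr.
  have := velocity0_cst cst t 0.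
  by rewrite subrr subr0 {1}/E flow0 id_lfunE.
move=> cf; apply/funext => t; rewrite (Eflow c cf t).
by rewrite (Eflow _ (flow_velocity f (c 0))) flow0.
Qed.

Lemma linear_ode_eq V (f : 'End(V)) (c d : R -> V) :
  (forall t, has_velocity c t (f (c t))) ->
  (forall t, has_velocity d t (f (d t))) -> c 0 = d 0 -> c = d.
Proof.
by move=> /linear_ode_unique cE /linear_ode_unique dE cd; rewrite cE cd -dE.
Qed.

End Flow.

(** * The curve [sigma X] as a flow *)

Section TrinomialSum.
Context {R : realType} {V : vectType R}.
Implicit Types (G : nat -> nat -> V) (F : nat -> nat -> nat -> V).

Definition binomial_sum (p : nat) G : V :=
  \sum_(i < p.+1) 'C(p, i)%:R *: G i (p - i)%N.

(** The inner sum of [exp2_partial_sum], with the vector attached to (i, j, k) left abstract. *)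
Definition trinomial_sum (n : nat) F : V :=
  \sum_(i < n) \sum_(j < n) \sum_(k < n | (i + j + k == n.-1)%N)
    'C(i + j, i)%:R *: F i j k.

Lemma binomial_sumS p G :
  binomial_sum p.+1 G =
    binomial_sum p (fun i j => G i.+1 j) + binomial_sum p (fun i j => G i j.+1).
Proof.
(* The added term i = p+1 has coefficient 'C(p, p+1) = 0; with it both sides of Pascal's rule run
   over the same range. *)
have <- : \sum_(i < p.+2) 'C(p, i)%:R *: G i (p.+1 - i)%N =
    binomial_sum p (fun i j => G i j.+1).
  rewrite big_ord_recr/= bin_small// scale0r addr0.
  by apply: eq_bigr => i _; rewrite subSn// -ltnS.
rewrite /binomial_sum !(@big_ord_recl _ _ _ p.+1)/= !bin0 addrCA; congr (_ + _).
rewrite -big_split; apply: eq_bigr => i _ /=.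
by rewrite /bump /= add1n binS natrD scalerDl addrC subSS.
Qed.

(** For fixed k, the constraint determines j from i when i <= n - 1 - k, and no j satisfies it for
    larger i. *)
Lemma trinomial_sumE n F :
  trinomial_sum n F =
    \sum_(k < n) binomial_sum (n.-1 - k) (fun i j => F i j k).
Proof.
rewrite /trinomial_sum; under eq_bigr do rewrite (exchange_big_dep xpredT)//=.
rewrite exchange_big; apply: eq_bigr => k _ /=; rewrite /binomial_sum.
have kn : (n.-1 - k < n)%N by have := ltn_ord k; lia.
rewrite (big_ord_widen n
  (fun i => 'C(n.-1 - k, i)%:R *: F i (n.-1 - k - i)%N k))//.
rewrite [RHS]big_mkcond; apply: eq_bigr => i _.
case: ifPn => ik.
  have jn : (n.-1 - k - i < n)%N by lia.
  rewrite (big_pred1 (Ordinal jn)) => [|j] /=.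
    by rewrite subnKC//; lia.
  by apply/idP/idP; rewrite -val_eqE/=; have := ltn_ord k; lia.
rewrite big_pred0// => j; have := ltn_ord k; lia.
Qed.

(** Pascal's rule in (i, j) for each k < n, plus the single new term at k = n. The three summands
    mirror the three terms of the third component of rho_X. *)
Lemma trinomial_sumS n F :
  trinomial_sum n.+1 F =
    trinomial_sum n (fun i j => F i.+1 j)
    + trinomial_sum n (fun i j => F i j.+1) + F 0%N 0%N n.
Proof.
rewrite !trinomial_sumE big_ord_recr/= -big_split/=; congr (_ + _).
  apply: eq_bigr => k _; rewrite -(binomial_sumS _ (fun i j => F i j k)).
  by congr binomial_sum; have := ltn_ord k; lia.
by rewrite subnn /binomial_sum big_ord1 bin0 scale1r.
Qed.

End TrinomialSum.

(** * The linear field rho_X and its powers at the identity *)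

Section Generator.
Context {R : realType} {V0 V1 : vectType R}.
Implicit Types (A B X Y : triple V0 V1).

Lemma part0_linear : linear (@part0 R V0 V1). Proof. by []. Qed.
Lemma part1_linear : linear (@part1 R V0 V1). Proof. by []. Qed.
Lemma part2_linear : linear (@part2 R V0 V1). Proof. by []. Qed.
HB.instance Definition _ := GRing.isSemilinear.Build R (triple V0 V1) 'End(V0)
  _ (@part0 R V0 V1) (GRing.semilinear_linear part0_linear).
HB.instance Definition _ := GRing.isSemilinear.Build R (triple V0 V1) 'End(V1)
  _ (@part1 R V0 V1) (GRing.semilinear_linear part1_linear).
HB.instance Definition _ := GRing.isSemilinear.Build R (triple V0 V1)
  'Hom(V0, 'Hom(V0, V1)) _ (@part2 R V0 V1)
  (GRing.semilinear_linear part2_linear).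

Section Parts.
Context (c : R -> triple V0 V1) (t : R) (v : triple V0 V1).
Hypothesis cv : has_velocity c t v.

Lemma has_velocity_part0 : has_velocity (fun s => part0 (c s)) t (part0 v).
Proof. exact: has_velocity_linear cv. Qed.

Lemma has_velocity_part1 : has_velocity (fun s => part1 (c s)) t (part1 v).
Proof. exact: has_velocity_linear cv. Qed.

Lemma has_velocity_part2 : has_velocity (fun s => part2 (c s)) t (part2 v).
Proof. exact: has_velocity_linear cv. Qed.

End Parts.

Lemma tripleP A B :
  (forall x, part0 A x = part0 B x) -> (forall a, part1 A a = part1 B a) ->
  (forall x y, part2 A x y = part2 B x y) -> A = B.
Proof.
case: A => [[A0 A1] A2]; case: B => [[B0 B1] B2] /= AB0 AB1 AB2.
by congr (_, _, _); apply/lfunP => x //; apply/lfunP.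
Qed.

Lemma part2_aut_comp B A x y :
  part2 (aut_comp B A) x y =
    part2 B (part0 A x) (part0 A y) + part1 B (part2 A x y).
Proof.
rewrite /aut_comp /part2/= bilinfunE// => [z a u v|z a u v].
  rewrite !linearP !add_lfunE !scale_lfunE linearP.
  by rewrite scalerDr addrACA.
by rewrite !linearP scalerDr addrACA.
Qed.

(** This is rho_X as a plain function; [right_generator] is the same map as an endomorphism, once
    linearity in A is established. *)
Definition right_generator_fun X A : triple V0 V1 :=
  mk_triple (part0 A \o part0 X)%VF (part1 A \o part1 X)%VF
    (bilinfun (fun x y => part2 A (part0 X x) y + part2 A x (part0 X y)
                          + part1 A (part2 X x y))).

Lemma part0_right_generator_fun X A x :
  part0 (right_generator_fun X A) x = part0 A (part0 X x).
Proof. exact: comp_lfunE. Qed.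

Lemma part1_right_generator_fun X A a :
  part1 (right_generator_fun X A) a = part1 A (part1 X a).
Proof. exact: comp_lfunE. Qed.

Lemma part2_right_generator_fun X A x y :
  part2 (right_generator_fun X A) x y =
    part2 A (part0 X x) y + part2 A x (part0 X y) + part1 A (part2 X x y).
Proof.
rewrite /part2/= bilinfunE// => [z a u v|z a u v].
  rewrite !linearP !add_lfunE !scale_lfunE !linearP.
  by rewrite !scalerDr [X in X + _ = _]addrACA [LHS]addrACA.
by rewrite !linearP !scalerDr [X in X + _ = _]addrACA [LHS]addrACA.
Qed.

Lemma right_generator_fun1 X : right_generator_fun X aut_id = X.
Proof.
apply: tripleP => [x|a|x y].
- by rewrite part0_right_generator_fun id_lfunE.
- by rewrite part1_right_generator_fun id_lfunE.
- by rewrite part2_right_generator_fun !zero_lfunE !add0r id_lfunE.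
Qed.

Lemma right_generator_fun_linear X : linear (right_generator_fun X).
Proof.
move=> a A B; apply: tripleP => [x|x|x y].
- by rewrite !linearP /= !lfun_simp.
- by rewrite !linearP /= !lfun_simp.
- rewrite !linearP !add_lfunE !scale_lfunE !part2_right_generator_fun.
  rewrite !linearP !add_lfunE !scale_lfunE.
  by rewrite !scalerDr [X in X + _ = _]addrACA [LHS]addrACA.
Qed.

Definition right_generator X : 'End(triple V0 V1) :=
  linfun (right_generator_fun X).

Lemma right_generatorE X A : right_generator X A = right_generator_fun X A.
Proof. exact/linfunE/right_generator_fun_linear. Qed.

(** [lfun_exp] iterates composition on the left, whereas rho_X composes on the right; the powers of
    f commute with f. *)
Lemma iter_comp_lfunSr (V : vectType R) (f : 'End(V)) n :
  iter n.+1 (comp_lfun f) \1%VF = (iter n (comp_lfun f) \1 \o f)%VF.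
Proof.
elim: n => [|n IHn]; first by rewrite /= comp_lfun1l comp_lfun1r.
by rewrite [LHS]iterS {1}IHn comp_lfunA.
Qed.

Lemma iter_comp_lfunE (V : vectType R) (f : 'End(V)) n x :
  iter n (comp_lfun f) \1%VF x = iter n f x.
Proof. by elim: n => [|n IHn]; rewrite ?id_lfunE//= comp_lfunE IHn. Qed.

Lemma part0_iter_right_generator X n :
  part0 (iter n (right_generator X) aut_id) =
    iter n (comp_lfun (part0 X)) \1%VF.
Proof.
elim: n => // n IHn; rewrite iter_comp_lfunSr -IHn.
by rewrite iterS right_generatorE.
Qed.

Lemma part1_iter_right_generator X n :
  part1 (iter n (right_generator X) aut_id) =
    iter n (comp_lfun (part1 X)) \1%VF.
Proof.
elim: n => // n IHn; rewrite iter_comp_lfunSr -IHn.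
by rewrite iterS right_generatorE.
Qed.

(** Induction with [trinomial_sumS]: the terms with X_0 x and X_0 y raise i and j, and the first n
    powers contribute X_1^n l_X(x, y) through the second component. *)
Lemma part2_iter_right_generator X n x y :
  part2 (iter n (right_generator X) aut_id) x y =
    trinomial_sum n (fun i j k => iter k (part1 X)
      (part2 X (iter i (part0 X) x) (iter j (part0 X) y))).
Proof.
elim: n x y => [|n IHn] x y.
  by rewrite /trinomial_sum big_ord0 /= !zero_lfunE.
rewrite iterS right_generatorE part2_right_generator_fun !IHn trinomial_sumS.
rewrite part1_iter_right_generator iter_comp_lfunE.
congr (_ + _ + _); rewrite /trinomial_sum.
  by do 3![apply: eq_bigr => ? _]; rewrite -iterSr.
by do 3![apply: eq_bigr => ? _]; rewrite -iterSr.
Qed.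

Lemma lfun_expE (V : vectType R) (f : 'End(V)) t :
  lfun_exp (t *: f) = power_curve (fun n => iter n (comp_lfun f) \1%VF) t.
Proof.
rewrite /lfun_exp /power_curve; congr vlim; apply/funext => N.
apply: eq_bigr => n _; rewrite mulrC -scalerA; congr (_ *: _).
elim: n => [|n IHn]; first by rewrite expr0 scale1r.
by rewrite !iterS IHn -comp_lfunZl -comp_lfunZr scalerA exprS.
Qed.

(** The sum in [exp2_partial_sum] starts at n = 1 and includes n = N. The term n = 0 of the power
    sum vanishes because the third component of [aut_id] is zero, hence the bound N+1. *)
Lemma exp2_partial_sumE X t x y N :
  exp2_partial_sum X t x y N =
    power_sum (fun n => part2 (iter n (right_generator X) aut_id) x y) t N.+1.
Proof.
rewrite /power_sum big_ltn// /= !zero_lfunE scaler0 add0r.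
by apply: eq_bigr => n _; rewrite part2_iter_right_generator.
Qed.

Lemma part2_flow X t x y :
  part2 (flow (right_generator X) aut_id t) x y =
    power_curve (fun n => part2 (iter n (right_generator X) aut_id) x y) t.
Proof.
have wb := geometrically_bounded_iter (right_generator X) aut_id.
have wb2 := geometrically_bounded_linear (@part2 R V0 V1) wb.
have wb2x := geometrically_bounded_linear (eval_lfun x) wb2.
rewrite (power_curve_linear (@part2 R V0 V1) t wb).
rewrite -[LHS]/(eval_lfun y (eval_lfun x _)).
by rewrite (power_curve_linear _ t wb2) (power_curve_linear _ t wb2x).
Qed.

Lemma exp2_partial_sum_cvg X t x y :
  vconverges (exp2_partial_sum X t x y)
    (part2 (flow (right_generator X) aut_id t) x y).
Proof.
rewrite part2_flow.
have wb := geometrically_bounded_iter (right_generator X) aut_id.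
have wb2 := geometrically_bounded_linear (@part2 R V0 V1) wb.
have wb2x := geometrically_bounded_linear (eval_lfun x) wb2.
have wb2xy := geometrically_bounded_linear (eval_lfun y) wb2x.
rewrite (_ : exp2_partial_sum _ _ _ _ =
  fun N => power_sum (eval_lfun y \o (eval_lfun x \o
    (@part2 R V0 V1 \o (fun n => iter n (right_generator X) aut_id)))) t N.+1).
  move: (power_sum_cvg (t := t) wb2xy); rewrite /vconverges.
  by rewrite -cvg_shiftS.
by apply/funext => N; rewrite exp2_partial_sumE.
Qed.

Lemma sigmaE X : sigma X = flow (right_generator X) aut_id.
Proof.
apply/funext => t.
have wb := geometrically_bounded_iter (right_generator X) aut_id.
rewrite [RHS](_ : _ = mk_triple (part0 (flow (right_generator X) aut_id t))
   (part1 (flow (right_generator X) aut_id t))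
   (part2 (flow (right_generator X) aut_id t))); last first.
  by case: (flow _ _ _) => [[]].
congr mk_triple.
- rewrite lfun_expE (power_curve_linear (@part0 R V0 V1) t wb).
  apply: (congr1 (fun w => power_curve w t)); apply/funext => n.
  exact/esym/part0_iter_right_generator.
- rewrite lfun_expE (power_curve_linear (@part1 R V0 V1) t wb).
  apply: (congr1 (fun w => power_curve w t)); apply/funext => n.
  exact/esym/part1_iter_right_generator.
(* The pointwise limits are the values of the third component of the flow, already a bilinear map,
   so [bilinfun] recovers that map. *)
- rewrite /exp2 -[RHS]bilinfun_lfun; apply: (congr1 bilinfun).
  apply/funext => x; apply/funext => y.
  exact/vlimE/exp2_partial_sum_cvg.
Qed.

End Generator.

(** * The homomorphism identities *)

Section Transport.
Context {R : realType} {V : vectType R} (f : 'End(V)).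
Implicit Types (v : V) (s t : R).

(** The moving argument e^((t-s)f) v: it reaches v at s = t, and its velocity is the negative of its
    image under f. *)
Definition transport v t s : V := flow f v (t - s).

Lemma transport_velocity v t s :
  has_velocity (transport v t) s (- f (transport v t s)).
Proof. exact/has_velocity_rev/flow_velocity. Qed.

Lemma transport_id v t : transport v t t = v.
Proof. by rewrite /transport subrr flow0. Qed.

End Transport.

Section ExponentialCurve.
Context {R : realType} {V0 V1 : vectType R} (X : triple V0 V1).
Context {c : R -> triple V0 V1}.
Hypothesis cX : forall s, has_velocity c s (right_generator_fun X (c s)).

Lemma part0_curve_velocity (u : R -> V0) s u' : has_velocity u s u' ->
  has_velocity (fun r => part0 (c r) (u r)) s
    (part0 (c s) (part0 X (u s) + u')).
Proof.
move=> uu'; have := has_velocity_app (has_velocity_part0 (cX s)) uu'.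
by rewrite part0_right_generator_fun -lfunD.
Qed.

Lemma part1_curve_velocity (u : R -> V1) s u' : has_velocity u s u' ->
  has_velocity (fun r => part1 (c r) (u r)) s
    (part1 (c s) (part1 X (u s) + u')).
Proof.
move=> uu'; have := has_velocity_app (has_velocity_part1 (cX s)) uu'.
by rewrite part1_right_generator_fun -lfunD.
Qed.

(** Each X_0 term of rho_X is grouped with the velocity of the same argument; the group vanishes
    when that argument is transported. *)
Lemma part2_curve_velocity (u v : R -> V0) s u' v' :
  has_velocity u s u' -> has_velocity v s v' ->
  has_velocity (fun r => part2 (c r) (u r) (v r)) s
    (part1 (c s) (part2 X (u s) (v s))
     + part2 (c s) (part0 X (u s) + u') (v s)
     + part2 (c s) (u s) (part0 X (v s) + v')).
Proof.
move=> uu' vv'.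
have part2u := has_velocity_app (has_velocity_part2 (cX s)) uu'.
have := has_velocity_app part2u vv'.
congr has_velocity; rewrite add_lfunE part2_right_generator_fun.
rewrite !lfunD add_lfunE -!addrA [X in _ + X]addrCA [LHS]addrCA.
by rewrite [X in _ + (_ + X) = _]addrCA.
Qed.

(** The motion of the argument compensates that of the curve. This lets the homomorphism identities
    keep A_0 x frozen at time t while the other terms move. *)
Lemma part0_curve_transport x t s :
  part0 (c s) (transport (part0 X) x t s) = part0 (c t) x.
Proof.
rewrite -[in RHS](transport_id (part0 X) x t).
apply: (velocity0_cst (c := fun r =>
  part0 (c r) (transport (part0 X) x t r))) => r.
have := part0_curve_velocity (transport_velocity (part0 X) x t r).
by rewrite subrr lfun0.
Qed.

Lemma part1_curve_transport a t s :
  part1 (c s) (transport (part1 X) a t s) = part1 (c t) a.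
Proof.
rewrite -[in RHS](transport_id (part1 X) a t).
apply: (velocity0_cst (c := fun r =>
  part1 (c r) (transport (part1 X) a t r))) => r.
have := part1_curve_velocity (transport_velocity (part1 X) a t r).
by rewrite subrr lfun0.
Qed.

Lemma part2_curve_transport_velocity x y t s :
  let p := transport (part0 X) x t in let q := transport (part0 X) y t in
  has_velocity (fun r => part2 (c r) (p r) (q r)) s
    (part1 (c s) (part2 X (p s) (q s))).
Proof.
move=> p q.
have := part2_curve_velocity (transport_velocity (part0 X) x t s)
  (transport_velocity (part0 X) y t s).
by rewrite !subrr !lfun0 zero_lfunE !addr0.
Qed.

Context {g : lie2_algebra V0 V1} (XD : derivation0 g X) (c0 : c 0 = aut_id).

Lemma curve_skew t x y : part2 (c t) x y = - part2 (c t) y x.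
Proof.
apply/eqP; rewrite -addr_eq0; apply/eqP.
pose p := transport (part0 X) x t; pose q := transport (part0 X) y t.
pose G s := part2 (c s) (p s) (q s) + part2 (c s) (q s) (p s).
have G0 s : has_velocity G s 0.
  have := has_velocityD (part2_curve_transport_velocity x y t s)
    (part2_curve_transport_velocity y x t s).
  by rewrite -lfunD (der_skew XD (transport _ x t s)) addNr lfun0.
have := velocity0_cst G0 t 0.
by rewrite /G /p /q !transport_id c0 /= !zero_lfunE addr0.
Qed.

Lemma curve_l2d t a :
  l2d g (part1 (c t) a) = part0 (c t) (l2d g a).
Proof.
apply/eqP; rewrite -subr_eq0; apply/eqP.
pose q := transport (part1 X) a t.
pose G s := l2d g (part1 (c s) (q s)) - part0 (c s) (l2d g (q s)).
have G0 s : has_velocity G s 0.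
  have q' := transport_velocity (part1 X) a t s.
  have := has_velocityB
    (has_velocity_lfun (l2d g) (part1_curve_velocity q'))
    (part0_curve_velocity (has_velocity_lfun (l2d g) q')).
  by rewrite subrr !lfun0 lfunN -(der_l2d XD) subrr lfun0 subrr.
have := velocity0_cst G0 t 0.
by rewrite /G /q !transport_id c0 /= !id_lfunE subrr.
Qed.

Lemma curve_br00 t x y :
  part0 (c t) (br00 g x y)
    - br00 g (part0 (c t) x) (part0 (c t) y)
  = l2d g (part2 (c t) x y).
Proof.
apply/eqP; rewrite -subr_eq0; apply/eqP.
pose p := transport (part0 X) x t; pose q := transport (part0 X) y t.
(* The bracket of images is frozen at time t, so it contributes no velocity. The other two
   contribute A_0 d l_X(p, q) and d A_1 l_X(p, q), which agree by [curve_l2d]. *)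
pose G s := part0 (c s) (br00 g (p s) (q s))
  - br00 g (part0 (c t) x) (part0 (c t) y)
  - l2d g (part2 (c s) (p s) (q s)).
have G0 s : has_velocity G s 0.
  have p' := transport_velocity (part0 X) x t s.
  have q' := transport_velocity (part0 X) y t s.
  have := has_velocityB (has_velocityB (part0_curve_velocity
      (has_velocity_app (has_velocity_lfun (br00 g) p') q'))
      (has_velocity_cst (br00 g (part0 (c t) x) (part0 (c t) y)) s))
    (has_velocity_lfun (l2d g) (part2_curve_transport_velocity x y t s)).
  by rewrite curve_l2d (der_br00 XD) subr0 -lfunB !lfunN opp_lfunE
    addrA subrr lfun0.
have := velocity0_cst G0 t 0.
rewrite /G -[in X in _ = X -> _](part0_curve_transport x t 0).
rewrite -[in X in _ = X -> _](part0_curve_transport y t 0).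
rewrite /p /q !transport_id c0 /= => ->.
by rewrite !id_lfunE !zero_lfunE lfun0 !subrr.
Qed.

(** As for [curve_br00]. Since X_0 d = d X_1, the argument d q is itself transported, so the A_2
    term again contributes only A_1 l_X. *)
Lemma curve_br01 t x a :
  part1 (c t) (br01 g x a)
    - br01 g (part0 (c t) x) (part1 (c t) a)
  = part2 (c t) x (l2d g a).
Proof.
apply/eqP; rewrite -subr_eq0; apply/eqP.
pose p := transport (part0 X) x t; pose q := transport (part1 X) a t.
pose G s := part1 (c s) (br01 g (p s) (q s))
  - br01 g (part0 (c t) x) (part1 (c t) a)
  - part2 (c s) (p s) (l2d g (q s)).
have G0 s : has_velocity G s 0.
  have p' := transport_velocity (part0 X) x t s.
  have q' := transport_velocity (part1 X) a t s.
  have := has_velocityB (has_velocityB (part1_curve_velocity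
      (has_velocity_app (has_velocity_lfun (br01 g) p') q'))
      (has_velocity_cst (br01 g (part0 (c t) x) (part1 (c t) a)) s))
    (part2_curve_velocity p' (has_velocity_lfun (l2d g) q')).
  rewrite subrr lfun0 zero_lfunE addr0 !lfunN -(der_l2d XD) subrr lfun0.
  rewrite addr0 (der_br01 XD) subr0 -lfunB opp_lfunE addrA.
  by rewrite subrr lfun0.
have := velocity0_cst G0 t 0.
rewrite /G -[in X in _ = X -> _](part0_curve_transport x t 0).
rewrite -[in X in _ = X -> _](part1_curve_transport a t 0).
rewrite /p /q !transport_id c0 /= => ->.
by rewrite !id_lfunE !zero_lfunE !subrr.
Qed.

Lemma l3_cycle x y z : l3 g x y z = l3 g y z x.
Proof. by rewrite l3_skew12 l3_skew23 opprK. Qed.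

(** The bracket of transported arguments is not transported: by [der_br00] its defect is d l_X(p,
    q). Skew-symmetry moves this defect to the second slot, the shape in which [curve_br01] produces
    it. *)
Lemma part2_curve_bracket_velocity x y z t s :
  let p := transport (part0 X) x t in let q := transport (part0 X) y t in
  let r := transport (part0 X) z t in
  has_velocity (fun u => part2 (c u) (br00 g (p u) (q u)) (r u)) s
    (- part1 (c s) (part2 X (r s) (br00 g (p s) (q s)))
     - part2 (c s) (r s) (l2d g (part2 X (p s) (q s)))).
Proof.
move=> p q r.
have p' := transport_velocity (part0 X) x t s.
have q' := transport_velocity (part0 X) y t s.
have r' := transport_velocity (part0 X) z t s.
have pq' := has_velocity_app (has_velocity_lfun (br00 g) p') q'.
have := part2_curve_velocity pq' r'.
congr has_velocity; rewrite subrr lfun0 addr0 (der_skew XD (br00 g _ _)).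
rewrite [X in _ + X = _]curve_skew (der_br00 XD) !lfunN opp_lfunE.
by rewrite -[in RHS]addrA.
Qed.

Lemma part1_curve_l3_velocity x y z t s :
  let p := transport (part0 X) x t in let q := transport (part0 X) y t in
  let r := transport (part0 X) z t in
  has_velocity (fun u => part1 (c u) (l3 g (p u) (q u) (r u))) s
    (let S x y z := part1 (c s) (part2 X x (br00 g y z))
                    + part1 (c s) (br01 g x (part2 X y z)) in
     S (p s) (q s) (r s) + S (q s) (r s) (p s) + S (r s) (p s) (q s)).
Proof.
move=> p q r.
have p' := transport_velocity (part0 X) x t s.
have q' := transport_velocity (part0 X) y t s.
have r' := transport_velocity (part0 X) z t s.
have l1 := has_velocity_lfun (l3 g) p'.
have l2 := has_velocity_app l1 q'.
have := part1_curve_velocity (has_velocity_app l2 r').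
congr has_velocity; rewrite (der_l3 XD) /= -!lfunD; congr (part1 _ _).
rewrite !lfunN !opp_lfunE add_lfunE !opp_lfunE.
rewrite -/(p s) -/(q s) -/(r s).
(* [der_l3] puts X_0 in the first slot of l_3, the Leibniz rule puts it in each slot in turn; cyclic
   rotation makes these terms cancel. *)
rewrite -(l3_cycle (p s) (part0 X (q s)) (r s)).
rewrite (l3_cycle (part0 X (r s)) (p s) (q s)).
move: (p s) (q s) (r s) => {p q r p' q' r' l1 l2} p q r.
move: (part2 X p _) (part2 X q _) (part2 X r _) (br01 g p _) (br01 g q _)
  (br01 g r _) (l3 g (part0 X p) q r) (l3 g p (part0 X q) r)
  (l3 g p q (part0 X r)) => a1 a2 a3 b1 b2 b3 d1 d2 d3.
by rewrite -!opprD (addrACA (a1 + b1)) (addrACA (_ + (a2 + b2))) addrK.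
Qed.

Lemma curve_l3 t x y z :
  br01 g (part0 (c t) x) (part2 (c t) y z)
    + br01 g (part0 (c t) y) (part2 (c t) z x)
    + br01 g (part0 (c t) z) (part2 (c t) x y)
    + l3 g (part0 (c t) x) (part0 (c t) y) (part0 (c t) z)
  = part2 (c t) (br00 g x y) z + part2 (c t) (br00 g y z) x
    + part2 (c t) (br00 g z x) y + part1 (c t) (l3 g x y z).
Proof.
apply/eqP; rewrite -subr_eq0; apply/eqP.
pose p := transport (part0 X) x t; pose q := transport (part0 X) y t.
pose r := transport (part0 X) z t.
set x' := part0 _ x; set y' := part0 _ y; set z' := part0 _ z.
have x'E s : x' = part0 (c s) (p s) by rewrite part0_curve_transport.
have y'E s : y' = part0 (c s) (q s) by rewrite part0_curve_transport.
have z'E s : z' = part0 (c s) (r s) by rewrite part0_curve_transport.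
pose G s := br01 g x' (part2 (c s) (q s) (r s))
    + br01 g y' (part2 (c s) (r s) (p s))
    + br01 g z' (part2 (c s) (p s) (q s)) + l3 g x' y' z'
  - (part2 (c s) (br00 g (p s) (q s)) (r s)
     + part2 (c s) (br00 g (q s) (r s)) (p s)
     + part2 (c s) (br00 g (r s) (p s)) (q s)
     + part1 (c s) (l3 g (p s) (q s) (r s))).
have G0 s : has_velocity G s 0.
  have h1 := has_velocity_lfun (br01 g x')
    (part2_curve_transport_velocity y z t s).
  have h2 := has_velocity_lfun (br01 g y')
    (part2_curve_transport_velocity z x t s).
  have h3 := has_velocity_lfun (br01 g z')
    (part2_curve_transport_velocity x y t s).
  have h4 := has_velocity_cst (l3 g x' y' z') s.
  have k1 := part2_curve_bracket_velocity x y z t s.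
  have k2 := part2_curve_bracket_velocity y z x t s.
  have k3 := part2_curve_bracket_velocity z x y t s.
  have k4 := part1_curve_l3_velocity x y z t s.
  have h := has_velocityD (has_velocityD (has_velocityD h1 h2) h3) h4.
  have k := has_velocityD (has_velocityD (has_velocityD k1 k2) k3) k4.
  have := has_velocityB h k.
  congr has_velocity; rewrite /= -/(p s) -/(q s) -/(r s).
  (* [curve_br01] trades brackets of images for images of brackets. Both sides of the identity are
     then sums of terms A_1 [u, l_X], A_1 l_X(u, [v, w]) and A_2(u, d l_X). *)
  have br01E u v w : br01 g (part0 (c s) u) (part1 (c s) (part2 X v w)) =
      part1 (c s) (br01 g u (part2 X v w))
      - part2 (c s) u (l2d g (part2 X v w)).
    by rewrite -curve_br01 opprB addrCA subrr addr0.
  rewrite (x'E s) (y'E s) (z'E s) !br01E.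
  rewrite addr0; move: (part2 (c s) (p s) _) (part2 (c s) (q s) _)
    (part2 (c s) (r s) _) => b1 b2 b3.
  move: (part2 X (p s) (br00 g _ _)) (part2 X (q s) (br00 g _ _))
    (part2 X (r s) (br00 g _ _)) => d1 d2 d3.
  move: (part1 (c s) d1) (part1 (c s) d2) (part1 (c s) d3) => {}d1 {}d2 {}d3.
  move: (br01 g (p s) _) (br01 g (q s) _) (br01 g (r s) _) => a1 a2 a3.
  move: (part1 (c s) a1) (part1 (c s) a2) (part1 (c s) a3) => {}a1 {}a2 {}a3.
  (* What remains is an additive identity between nine arbitrary vectors, checked on each
     coordinate. *)
  by apply: coordsP => i; rewrite linear0 !(linearD, linearN) !mxE; ring.
have := velocity0_cst G0 t 0.
rewrite /G /p /q /r !transport_id => ->.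
rewrite (x'E 0) (y'E 0) (z'E 0) c0.
by rewrite !zero_lfunE !lfun0 !id_lfunE !add0r subrr.
Qed.

Lemma curve_hom t : lie2_hom g (c t).
Proof.
by split; [exact: curve_skew|exact: curve_l2d|exact: curve_br00
          |exact: curve_br01|exact: curve_l3].
Qed.

End ExponentialCurve.

(** * The group law and uniqueness *)

Section ComponentwiseVelocity.
Context {R : realType}.
Implicit Types U V W : vectType R.

(** A linear map depends linearly on its finitely many values on a basis; [T i w] is the rank-one
    map formed from the i-th coordinate and w. *)
Lemma has_velocity_pointwise V W (F : R -> 'Hom(V, W)) t (F' : 'Hom(V, W)) :
  (forall x, has_velocity (fun s => F s x) t (F' x)) -> has_velocity F t F'.
Proof.
move=> FF'.
pose T i (w : W) : 'Hom(V, W) := linfun (fun x => coords x 0 i *: w).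
have TE i w x : T i w x = coords x 0 i *: w.
  by rewrite linfunE// => a u v; rewrite linearP !mxE scalerDl scalerA.
pose L i : 'Hom(W, 'Hom(V, W)) := linfun (T i).
have LE i w : L i w = T i w.
  rewrite linfunE// => a u v; apply/lfunP => x.
  by rewrite add_lfunE scale_lfunE !TE scalerDr !scalerA [_ * a]mulrC.
have decomp (G : 'Hom(V, W)) : G = \sum_i L i (G (vbasis {:V})`_i).
  apply/lfunP => x; rewrite sum_lfunE {1}(coords_sum_basis x) linear_sum.
  by apply: eq_bigr => i _; rewrite LE TE linearZ.
rewrite (decomp F') (_ : F = fun s => \sum_i L i (F s (vbasis {:V})`_i)).
  by apply: has_velocity_sum => i; exact: has_velocity_lfun.
by apply/funext => s; rewrite -decomp.
Qed.

Context {V0 V1 : vectType R}.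

Lemma has_velocity_triple (c : R -> triple V0 V1) t (v : triple V0 V1) :
  (forall x, has_velocity (fun s => part0 (c s) x) t (part0 v x)) ->
  (forall a, has_velocity (fun s => part1 (c s) a) t (part1 v a)) ->
  (forall x y, has_velocity (fun s => part2 (c s) x y) t (part2 v x y)) ->
  has_velocity c t v.
Proof.
move=> /has_velocity_pointwise c0 /has_velocity_pointwise c1 c2.
have {}c2 : has_velocity (fun s => part2 (c s)) t (part2 v).
  by apply: has_velocity_pointwise => x; exact: has_velocity_pointwise.
pose L0 : 'Hom('End(V0), triple V0 V1) := linfun (fun F => mk_triple F 0 0).
pose L1 : 'Hom('End(V1), triple V0 V1) := linfun (fun F => mk_triple 0 F 0).
pose L2 : 'Hom('Hom(V0, 'Hom(V0, V1)), triple V0 V1) :=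
  linfun (fun F => mk_triple 0 0 F).
have L0E F : L0 F = mk_triple F 0 0.
  rewrite linfunE// => a u w.
  by rewrite -[RHS]/(a *: u + w, a *: 0 + 0, a *: 0 + 0) !scaler0 !addr0.
have L1E F : L1 F = mk_triple 0 F 0.
  rewrite linfunE// => a u w.
  by rewrite -[RHS]/(a *: 0 + 0, a *: u + w, a *: 0 + 0) !scaler0 !addr0.
have L2E F : L2 F = mk_triple 0 0 F.
  rewrite linfunE// => a u w.
  by rewrite -[RHS]/(a *: 0 + 0, a *: 0 + 0, a *: u + w) !scaler0 !addr0.
have decomp A : A = L0 (part0 A) + L1 (part1 A) + L2 (part2 A).
  rewrite L0E L1E L2E; case: A => [[A0 A1] A2].
  by rewrite -[RHS]/(A0 + 0 + 0, 0 + A1 + 0, 0 + 0 + A2) !(addr0, add0r).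
rewrite (decomp v) (_ : c = fun s =>
  L0 (part0 (c s)) + L1 (part1 (c s)) + L2 (part2 (c s))).
  by apply: has_velocityD; [apply: has_velocityD|]; exact: has_velocity_lfun.
by apply/funext => s; rewrite -decomp.
Qed.

End ComponentwiseVelocity.

(** * One-parameter subgroups as integral curves of rho_X *)

Section OneParameterSubgroups.
Context {R : realType} {V0 V1 : vectType R}.
Implicit Types (A B X Y : triple V0 V1) (c : R -> triple V0 V1).

Lemma part0_aut_comp B A x : part0 (aut_comp B A) x = part0 B (part0 A x).
Proof. exact: comp_lfunE. Qed.

Lemma part1_aut_comp B A a : part1 (aut_comp B A) a = part1 B (part1 A a).
Proof. exact: comp_lfunE. Qed.

Lemma aut_comp1r B : aut_comp B aut_id = B.
Proof.
apply: tripleP => [x|a|x y]; rewrite ?part0_aut_comp ?part1_aut_comp.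
- by rewrite id_lfunE.
- by rewrite id_lfunE.
- by rewrite part2_aut_comp /= !id_lfunE !zero_lfunE lfun0 addr0.
Qed.

(** This is the left invariance of rho_X. Left multiplication is not linear in c(s), as B_2(A_0 x,
    A_0 y) is quadratic in A, so the Leibniz rule is applied to the evaluated components. *)
Lemma aut_comp_velocity B c t X :
  has_velocity c t (right_generator_fun X (c t)) ->
  has_velocity (fun s => aut_comp B (c s)) t
    (right_generator_fun X (aut_comp B (c t))).
Proof.
move=> cX.
have c0 x : has_velocity (fun s => part0 (c s) x) t
    (part0 (c t) (part0 X x)).
  rewrite -part0_right_generator_fun.
  exact/has_velocity_eval/has_velocity_part0.
have c1 a : has_velocity (fun s => part1 (c s) a) t
    (part1 (c t) (part1 X a)).
  rewrite -part1_right_generator_fun.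
  exact/has_velocity_eval/has_velocity_part1.
have c2 x y : has_velocity (fun s => part2 (c s) x y) t
    (part2 (right_generator_fun X (c t)) x y).
  have c2x := has_velocity_eval x (has_velocity_part2 cX).
  exact: has_velocity_eval y c2x.
apply: has_velocity_triple => [x|a|x y].
- rewrite part0_right_generator_fun part0_aut_comp.
  under eq_fun do rewrite part0_aut_comp.
  exact/has_velocity_lfun/c0.
- rewrite part1_right_generator_fun part1_aut_comp.
  under eq_fun do rewrite part1_aut_comp.
  exact/has_velocity_lfun/c1.
- under eq_fun do rewrite part2_aut_comp.
  rewrite part2_right_generator_fun !part2_aut_comp part1_aut_comp.
  have h1 := has_velocity_app (has_velocity_lfun (part2 B) (c0 x)) (c0 y).
  have h2 := has_velocity_lfun (part1 B) (c2 x y).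
  have := has_velocityD h1 h2; congr has_velocity.
  rewrite part2_right_generator_fun !lfunD.
  by rewrite [LHS]addrA [X in X + _ = _]addrACA.
Qed.

(** Near t, c(s) = c(t) \diamond c(s - t), so left invariance carries the velocity at 0 to time
    t. *)
Lemma homomorphism_velocity c X :
  c 0 = aut_id -> (forall s t, c (s + t) = aut_comp (c s) (c t)) ->
  has_velocity c 0 X ->
  forall t, has_velocity c t (right_generator_fun X (c t)).
Proof.
move=> c0 cD cX t.
have cX0 : has_velocity c 0 (right_generator_fun X (c 0)).
  by rewrite c0 right_generator_fun1.
have := aut_comp_velocity (c t) cX0; rewrite c0 aut_comp1r => h.
have := @has_velocity_shift _ _ (fun s => aut_comp (c t) (c s)) (- t) t
  (right_generator_fun X (c t)).
rewrite addNr => /(_ h).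
by under eq_fun do rewrite -cD addrA subrr add0r.
Qed.

Lemma homomorphism_unique c X :
  c 0 = aut_id -> (forall s t, c (s + t) = aut_comp (c s) (c t)) ->
  has_velocity c 0 X -> c = sigma X.
Proof.
move=> c0 cD cX; rewrite sigmaE -c0; apply: linear_ode_unique => t.
by rewrite right_generatorE; exact: homomorphism_velocity.
Qed.

Lemma sigma0 X : sigma X 0 = aut_id.
Proof. by rewrite sigmaE flow0. Qed.

Lemma sigma_velocity X s :
  has_velocity (sigma X) s (right_generator_fun X (sigma X s)).
Proof. by rewrite sigmaE -right_generatorE; exact: flow_velocity. Qed.

Lemma sigmaD X s t : sigma X (s + t) = aut_comp (sigma X s) (sigma X t).
Proof.
have := @linear_ode_eq _ _ (right_generator X) (fun r => sigma X (s + r))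
  (fun r => aut_comp (sigma X s) (sigma X r)).
rewrite addr0 sigma0 aut_comp1r => sD.
apply: (congr1 (fun f => f t) (sD _ _ erefl)) => r; rewrite right_generatorE.
  exact/has_velocity_shift/sigma_velocity.
exact/aut_comp_velocity/sigma_velocity.
Qed.

Lemma sigma_velocity0 X : has_velocity (sigma X) 0 X.
Proof.
by have := sigma_velocity X 0; rewrite sigma0 right_generator_fun1.
Qed.

Lemma sigma_Aut0 (g : lie2_algebra V0 V1) X t : Der0 g X -> Aut0 g (sigma X t).
Proof.
move=> XD; split.
- exact: (curve_hom (sigma_velocity X) XD (sigma0 X)).
(* The group law at t and -t supplies the inverse of each component. *)
- exists (part0 (sigma X (- t))) => x; rewrite -part0_aut_comp -sigmaD.
    by rewrite addNr sigma0 id_lfunE.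
  by rewrite subrr sigma0 id_lfunE.
- exists (part1 (sigma X (- t))) => a; rewrite -part1_aut_comp -sigmaD.
    by rewrite addNr sigma0 id_lfunE.
  by rewrite subrr sigma0 id_lfunE.
Qed.

Lemma sigma_one_parameter_subgroup (g : lie2_algebra V0 V1) X :
  Der0 g X -> one_parameter_subgroup_of g X (sigma X).
Proof.
move=> XD; split; last exact: sigma_velocity0.
split; [by move=> t; exact: sigma_Aut0| |exact: sigma0|exact: sigmaD].
by rewrite sigmaE; exact: flow_smooth.
Qed.

End OneParameterSubgroups.

Theorem lemma5p3 (R : realType) (V0 V1 : vectType R) (g : lie2_algebra V0 V1) :
  [/\ forall X : triple V0 V1, Der0 g X -> forall (t : R) (x y : V0),
        vconverges (exp2_partial_sum X t x y) (part2 (sigma X t) x y),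
      forall X : triple V0 V1, Der0 g X ->
        one_parameter_subgroup g (sigma X) /\ has_velocity (sigma X) 0 X
    & is_exponential_map g (fun X : triple V0 V1 => sigma X 1)].
Proof.
split=> [X _ t x y|X XD|X XD].
(* [vlim] has a value for every sequence; this clause certifies that the series in [exp2] does
   converge to the value taken. *)
- by rewrite sigmaE; exact: exp2_partial_sum_cvg.
- exact: sigma_one_parameter_subgroup.
- have uniq c : one_parameter_subgroup_of g X c -> c = sigma X.
    by move=> [[_ _ c0 cD] cX]; exact: homomorphism_unique.
  split; first exact: sigma_Aut0.
    exists (sigma X); split; first exact: sigma_one_parameter_subgroup.
    by move=> c /uniq.
  by move=> c /uniq ->.
Qed.
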